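(* Let $\mathbb{Q}$ be the hierarchical mesh associated with a clustered hierarchy of subdomains $\{\Omega_0,\dots,\Omega_n\}$ of $\Omega=[0,1]^d$. Then $\mathbb{Q}$ is a weakly admissible hierarchical mesh if and only if, for every $\ell\in\{1,\dots,n-1\}$ and every cell $Q\in\mathcal{Q}_\ell$ such that $Q\subset\Omega_\ell$, it holds that $\mathcal{N}_Q\cap\Omega_0\subset\Omega_{\ell-1}$.
   Context: Fix integers $d\ge 1$, $p\ge 1$ and let $\Omega=\Omega_0=[0,1]^d$. For $\ell\in\mathbb{Z}$, $\mathcal{Q}^\infty_\ell$ is the set of closed cubes $2^{-\ell}(\mathbf{k}+[0,1]^d)$, $\mathbf{k}\in\mathbb{Z}^d$ (cells of level $\ell$); for $\ell\ge 0$, $\mathcal{Q}_\ell$ is the set of cells of level $\ell$ contained in $\Omega$. $\mathbf{B}^\infty_{\mathbf{p},\ell}$ is the set of cubes $\prod_{i=1}^d[\tfrac{k_i}{2^\ell},\tfrac{k_i+p+1}{2^\ell}]$, $\mathbf{k}\in\mathbb{Z}^d$ (supports of the cardinal tensor-product B-splines of degree $p$ and level $\ell$). For $Q\in\mathcal{Q}^\infty_\ell$: $\mathrm{parent}(Q)$ is the unique cell of level $\ell-1$ containing $Q$; $\widehat{Q}$ is the union of all $C\in\mathbf{B}^\infty_{\mathbf{p},\ell}$ with $Q\subset C$; and $\mathcal{N}_Q:=\bigcup\{\mathrm{parent}(Q^* ) : Q^*\in\mathcal{Q}^\infty_\ell,\ Q^*\subset\widehat{Q}\}$. The set of $\mathbf{p}$-forms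 of level $\ell$ is $\mathbf{F}^\infty_{\mathbf{p},\ell}:=\{C\in\mathbf{B}^\infty_{\mathbf{p},\ell} : \exists\,Q\in\mathcal{Q}^\infty_{\ell+1}\text{ with }Q\subset\Omega_0,\ \widehat Q\subset C\}$. For $\ell\ge0$, $\mathcal{B}_\ell$ is the tensor-product B-spline basis on $\Omega$ with mesh $\mathcal{Q}_\ell$, degree $p$ in each direction and maximum smoothness; supports are intersected with $\Omega$. For $Q\in\mathcal{Q}_\ell$, the support extension is $\tilde Q:=\bigcup\{\operatorname{supp}\beta : \beta\in\mathcal{B}_\ell,\ Q\subset\operatorname{supp}\beta\}$, equivalently $\tilde Q=\widehat Q\cap\Omega_0$. A hierarchy of subdomains of depth $n$ is $\{\Omega_0,\dots,\Omega_n\}$ with $\Omega=\Omega_0\supset\Omega_1\supset\dots\supset\Omega_{n-1}\supset\Omega_n=\emptyset$, where $\Omega_\ell$ is a union of cells of level $\ell-1$ for $\ell=1,\dots,n-1$. It is clustered if for every $\ell=1,\dots,n-1$ there is a family $\{C_i\}_{i\in J}\subset\mathbf{F}^\infty_{\mathbf{p},\ell-1}$ with $\Omega_\ell=\bigcup_{i\in J}(C_i\cap\Omega_0)$. The hierarchical mesh is $\mathbb{Q}:=\bigcup_{\ell=0}^{n-1}\{Q\in\mathcal{Q}_\ell : Q\subset\Omega_\ell,\ Q\not\subset\Omega_{\ell+1}\}$. For $\ell=0,\dots,n-1$, $\omega_\ell:=\bigcup\{Q\in\mathcal{Q}_\ell : \tilde Q\subset\Omega_\ell\}$. The mesh $\mathbb{Q}$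 is a weakly admissible hierarchical mesh (WAHM) if $\omega_\ell\subset\omega_{\ell-1}$ for all $\ell=1,\dots,n-1$. *)

(* Defs.v *)
From HB Require Import structures.
From mathcomp Require Import all_boot all_order all_algebra.
From mathcomp Require Import all_classical all_reals all_analysis.
Set Implicit Arguments.
Unset Strict Implicit.
Unset Printing Implicit Defensive.
Import Order.TTheory GRing.Theory Num.Theory.
Import numFieldNormedType.Exports.
Local Open Scope classical_set_scope.
Local Open Scope ring_scope.

Definition unit_cube (R : realType) (d : nat) : set 'rV[R]_d :=
  [set x : 'rV[R]_d | forall i : 'I_d, 0 <= x ord0 i <= 1].

(* The closed cube 2^-l (k + [0,w]^d). *)
Definition grid_cube (R : realType) (d : nat) (l : int) (w : nat)
    (k : 'I_d -> int) : set 'rV[R]_d :=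
  [set x : 'rV[R]_d | forall i : 'I_d,
     (2 : R) ^ (- l) * (k i)%:~R <= x ord0 i
       <= (2 : R) ^ (- l) * (k i + w%:Z)%:~R].

Definition cells_infty (R : realType) (d : nat) (l : int) :
    set (set 'rV[R]_d) :=
  [set Q | exists k : 'I_d -> int, Q = grid_cube l 1 k].

Definition cells (R : realType) (d : nat) (l : nat) : set (set 'rV[R]_d) :=
  [set Q | cells_infty l%:Z Q /\ Q `<=` @unit_cube R d].

(* The supports of the cardinal tensor-product B-splines of degree p, level l. *)
Definition bspline_cubes (R : realType) (d p : nat) (l : int) :
    set (set 'rV[R]_d) :=
  [set C | exists k : 'I_d -> int, C = grid_cube l p.+1 k].

(* The definite description of the cell of level l - 1 containing Q, which
   exists and is unique as soon as Q is a cell of level l. *)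
Definition parent (R : realType) (d : nat) (l : int) (Q : set 'rV[R]_d) :
    set 'rV[R]_d :=
  get [set P | cells_infty (l - 1) P /\ Q `<=` P].

Definition hat (R : realType) (d p : nat) (l : int) (Q : set 'rV[R]_d) :
    set 'rV[R]_d :=
  \bigcup_(C in [set C | bspline_cubes p l C /\ Q `<=` C]) C.

Definition coarse_nbhd (R : realType) (d p : nat) (l : int)
    (Q : set 'rV[R]_d) : set 'rV[R]_d :=
  \bigcup_(Q' in [set Q' | cells_infty l Q' /\ Q' `<=` hat p l Q])
    parent l Q'.

Definition pforms (R : realType) (d p : nat) (l : int) :
    set (set 'rV[R]_d) :=
  [set C | bspline_cubes p l C /\
     exists Q : set 'rV[R]_d, [/\ cells_infty (l + 1) Q,
       Q `<=` @unit_cube R d & hat p (l + 1) Q `<=` C]].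

(* Univariate cardinal B-spline of degree q with knots 0, 1, ..., q + 1
   (Cox-de Boor recursion). *)
Fixpoint cardinal_bspline (R : realType) (q : nat) (x : R) : R :=
  match q with
  | 0%N => if 0 <= x < 1 then 1 else 0
  | q'.+1 => x / q%:R * cardinal_bspline q' x
             + (q%:R + 1 - x) / q%:R * cardinal_bspline q' (x - 1)
  end.

Definition tensor_bspline (R : realType) (d p l : nat) (k : 'I_d -> int)
    (x : 'rV[R]_d) : R :=
  \prod_(i < d) cardinal_bspline p (2 ^+ l * x ord0 i - (k i)%:~R).

(* The cardinal tensor-product B-splines that do not vanish identically on the
   unit cube. Their restrictions to it are the basis
   functions; a restriction is represented here by the function on the whole
   space, and [supp] intersects the support with the unit cube. *)
Definition bspline_basis (R : realType) (d p l : nat) :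
    set ('rV[R]_d -> R) :=
  [set b | exists k : 'I_d -> int, b = tensor_bspline p l k /\
     exists2 x : 'rV[R]_d, unit_cube x & b x != 0].

Definition supp (R : realType) (d : nat) (b : 'rV[R]_d -> R) :
    set 'rV[R]_d :=
  closure [set x : 'rV[R]_d | b x != 0] `&` @unit_cube R d.

Definition support_ext (R : realType) (d p l : nat) (Q : set 'rV[R]_d) :
    set 'rV[R]_d :=
  \bigcup_(b in [set b | bspline_basis p l b /\ Q `<=` supp b]) supp b.

(* The condition Om n = set0 forces 0 < n. Only Om 0, ..., Om n are used. *)
Definition hierarchy (R : realType) (d n : nat) (Om : nat -> set 'rV[R]_d) :
    Prop :=
  [/\ Om 0%N = @unit_cube R d,
      forall l : nat, (l < n)%N -> Om l.+1 `<=` Om l,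
      Om n = set0 &
      forall l : nat, (1 <= l < n)%N ->
        exists2 A : set (set 'rV[R]_d), A `<=` cells_infty (l%:Z - 1) &
          Om l = \bigcup_(Q in A) Q].

Definition clustered (R : realType) (d p n : nat)
    (Om : nat -> set 'rV[R]_d) : Prop :=
  forall l : nat, (1 <= l < n)%N ->
    exists2 A : set (set 'rV[R]_d), A `<=` pforms p (l%:Z - 1) &
      Om l = \bigcup_(C in A) (C `&` Om 0%N).

Definition hierarchical_mesh (R : realType) (d n : nat)
    (Om : nat -> set 'rV[R]_d) : set (set 'rV[R]_d) :=
  \bigcup_(l in [set l : nat | (l < n)%N])
    [set Q | [/\ cells l Q, Q `<=` Om l & ~ (Q `<=` Om l.+1)]].

Definition omega (R : realType) (d p : nat) (Om : nat -> set 'rV[R]_d)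
    (l : nat) : set 'rV[R]_d :=
  \bigcup_(Q in [set Q | cells l Q /\ support_ext p l Q `<=` Om l]) Q.

(* The mesh M is the weakly admissible hierarchical mesh of the hierarchy Om. *)
Definition WAHM (R : realType) (d p n : nat) (Om : nat -> set 'rV[R]_d)
    (M : set (set 'rV[R]_d)) : Prop :=
  M = hierarchical_mesh n Om /\
  forall l : nat, (1 <= l < n)%N -> omega p Om l `<=` omega p Om l.-1.

(* Main.v *)
Require Import Defs.
From HB Require Import structures.
From mathcomp Require Import all_boot all_order all_algebra.
From mathcomp Require Import all_classical all_reals all_analysis.
From mathcomp Require Import zify ring lra.
Import Order.TTheory GRing.Theory Num.Theory.
Import numFieldNormedType.Exports.
Local Open Scope classical_set_scope.
Local Open Scope ring_scope.

(** All the sets involved are boxes with corners on a dyadic grid, so the proof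
turns each of them into a pair of integer vectors and then argues one
coordinate at a time. For the cell of index [k] at level [l + 1], the hat goes
from [k - p] to [k + p + 1] in units of that level ([hatE]) and the coarse
neighbourhood from [(k - p) %/ 2] to [(k + p) %/ 2 + 1] in units of level [l]
([coarse_nbhdE]). The support extension is the trace of the hat on the unit
cube ([support_extE]), because the cardinal B-spline of degree [p] is positive
on the open interval from 0 to [p + 1] and zero outside the closed one.

Suppose first that coarse neighbourhoods of cells of [Om l.+1] stay in [Om l],
let the cell [k] have its support extension in [Om l.+1], and let [a] be its
parent. Any cell [m] of level [l] in the support extension of [a] has a child
at distance at most [2 * p] from [k]; halfway, at distance at most [p] from
both, lies a cell [k1] contained in [Om l.+1], and [m] belongs to the coarse
neighbourhood of [k1]. Thus the support extension of [a] lies in [Om l]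
([omega_sub_of_coarse_nbhd]).

Conversely, let the cell [k] lie in [Om l.+1]. Clustering puts it in a p-form
of level [l], going from [j] to [j + p + 1], whose trace lies in [Om l.+1]. The
cells of level [l + 1] with hat inside this p-form have all their coordinates
equal to [2j + p] or [2j + p + 1]; those in the unit cube therefore contribute
to [omega p Om l.+1], hence to [omega p Om l], so that the support extensions
of their parents lie in [Om l]. For even [p] one such parent is enough to cover
the coarse neighbourhood of [k]. For odd [p] the two admissible coordinates
have different parents, and the support extension of either one may miss a
layer of cells on the far side; so the central cell is chosen, coordinate by
coordinate, according to the point to be covered ([coarse_nbhd_sub_of_omega]).
*)

(** * Dyadic boxes and cells *)

(** Bounds and coordinates are compared after scaling by [2 ^+ l], so that
integer bounds can be handed to linear integer arithmetic. *)
Definition dyadic_box {R : realType} {d : nat} (l : nat) (a b : 'I_d -> int) :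
    set 'rV[R]_d :=
  [set x | forall i, (a i)%:~R <= 2 ^+ l * x ord0 i <= (b i)%:~R].

Definition dyadic_cell {R : realType} {d : nat} (l : nat) (k : 'I_d -> int) :
    set 'rV[R]_d :=
  dyadic_box l k (fun i => k i + 1).

Definition grid_point {R : realType} {d : nat} (l : nat) (t : 'I_d -> R) :
    'rV[R]_d :=
  \row_i (t i / 2 ^+ l).

Lemma pow2_gt0 (R : realType) (l : nat) : 0 < (2 : R) ^+ l.
Proof. by rewrite exprn_gt0. Qed.

Lemma grid_pointE {R : realType} {d : nat} (l : nat) (t : 'I_d -> R) i :
  2 ^+ l * grid_point l t ord0 i = t i.
Proof.
have h := pow2_gt0 R l.
by rewrite mxE; field; lra.
Qed.

Lemma grid_cubeE {R : realType} {d : nat} (l w : nat) (k : 'I_d -> int) :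
  @grid_cube R d l%:Z w k = dyadic_box l k (fun i => k i + w%:Z).
Proof.
have h := pow2_gt0 R l.
rewrite /grid_cube /dyadic_box -exprz_inv -exprnP exprVn.
by apply/seteqP; split => x /= hx i; have := hx i;
  rewrite ![_^-1 * _]mulrC ler_pdivrMr // ler_pdivlMr // [_ * x _ _]mulrC.
Qed.

Lemma cells_inftyE {R : realType} {d : nat} (l : nat) (Q : set 'rV[R]_d) :
  cells_infty l%:Z Q <-> exists k, Q = dyadic_cell l k.
Proof. by split=> -[k ->]; exists k; rewrite grid_cubeE. Qed.

Lemma bspline_cubesE {R : realType} {d : nat} (p l : nat) (C : set 'rV[R]_d) :
  bspline_cubes p l%:Z C <->
  exists k, C = dyadic_box l k (fun i => k i + p.+1%:Z).
Proof. by split=> -[k ->]; exists k; rewrite grid_cubeE. Qed.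

Lemma unit_cubeE {R : realType} {d : nat} (l : nat) :
  @unit_cube R d = dyadic_box l (fun=> 0) (fun=> (2 ^ l)%N%:Z).
Proof.
have h := pow2_gt0 R l.
by apply/seteqP; split => x /= hx i; have := hx i;
  rewrite mulr0z -pmulrn natrX pmulr_rge0 // ger_pMr.
Qed.

Lemma dyadic_box_refine {R : realType} {d : nat} (l : nat)
    (a b : 'I_d -> int) :
  @dyadic_box R d l a b =
  dyadic_box l.+1 (fun i => 2 * a i) (fun i => 2 * b i).
Proof.
by apply/seteqP; split => x hx i; have := hx i;
  rewrite exprS !intrM -mulrA !(ler_pM2l (ltr0n R 2)).
Qed.

Lemma dyadic_box_mono {R : realType} {d : nat} (l : nat)
    (a b a' b' : 'I_d -> int) :
  (forall i, a' i <= a i /\ b i <= b' i) ->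
  @dyadic_box R d l a b `<=` dyadic_box l a' b'.
Proof.
move=> le x hx i; have [le1 le2] := le i; have /andP[h1 h2] := hx i.
by rewrite (le_trans _ h1) ?ler_int // (le_trans h2) ?ler_int.
Qed.

(** The two extreme corners of the smaller box, which belong to it, give the
bounds. *)
Lemma dyadic_box_sub {R : realType} {d : nat} (l : nat)
    (a b a' b' : 'I_d -> int) :
  (forall i, a i <= b i) ->
  @dyadic_box R d l a b `<=` dyadic_box l a' b' <->
  forall i, a' i <= a i /\ b i <= b' i.
Proof.
move=> ab; split=> [sub i|]; last exact: dyadic_box_mono.
have /sub/(_ i) : dyadic_box l a b (grid_point l (fun i => (a i)%:~R : R)).
  by move=> j; rewrite grid_pointE lexx ler_int ab.
have /sub/(_ i) : dyadic_box l a b (grid_point l (fun i => (b i)%:~R : R)).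
  by move=> j; rewrite grid_pointE lexx ler_int ab.
by rewrite !grid_pointE !ler_int => /andP[_ ->] /andP[-> _].
Qed.

Lemma cell_sub_box {R : realType} {d : nat} (l : nat) (k a b : 'I_d -> int) :
  @dyadic_cell R d l k `<=` dyadic_box l a b <->
  forall i, a i <= k i < b i.
Proof.
rewrite dyadic_box_sub => [|i]; last by lia.
by split=> h i; have := h i; lia.
Qed.

Definition cell_center {R : realType} {d : nat} (l : nat) (k : 'I_d -> int) :
    'rV[R]_d :=
  grid_point l (fun i => (k i)%:~R + 2^-1).

Lemma cell_center_in {R : realType} {d : nat} (l : nat) (k : 'I_d -> int) :
  dyadic_cell l k (@cell_center R d l k).
Proof. by move=> i; rewrite grid_pointE intrD; lra. Qed.

(** Centers of cells avoid all grid hyperplanes of their level. This is how a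
cell contained in a union of closed boxes is located inside a single one of
them. *)
Lemma center_in_box {R : realType} {d : nat} (l : nat) (k a b : 'I_d -> int) :
  dyadic_box l a b (@cell_center R d l k) -> forall i, a i <= k i < b i.
Proof.
move=> h i; have := h i; rewrite grid_pointE => /andP[h1 h2].
have : (a i)%:~R < (k i + 1)%:~R :> R by rewrite intrD; lra.
have : (k i)%:~R < (b i)%:~R :> R by lra.
by rewrite !ltr_int; lia.
Qed.

(** Closed boxes may meet along a face without sharing a cell, hence the strict
inequality: it makes every common point, even one on the boundary, lie in a
cell common to both. *)
Lemma dyadic_box_cell {R : realType} {d : nat} (l : nat)
    (a b a' b' : 'I_d -> int) (x : 'rV[R]_d) :
  (forall i, Order.max (a i) (a' i) < Order.min (b i) (b' i)) ->
  dyadic_box l a b x -> dyadic_box l a' b' x ->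
  exists2 m : 'I_d -> int,
    dyadic_cell l m x & forall i, a i <= m i < b i /\ a' i <= m i < b' i.
Proof.
move=> ne hx hx'.
pose f i := Num.floor (2 ^+ l * x ord0 i).
(* The integer part fails only on the upper face, where one steps back by 1. *)
exists (fun i => Order.min (f i) (Order.min (b i) (b' i) - 1)) => i.
  have := floor_itv (2 ^+ l * x ord0 i); rewrite -/(f i) => /andP[f1 f2].
  have /andP[h1 h2] := hx i; have /andP[h1' h2'] := hx' i.
  have [le|lt] := leP (f i) (Order.min (b i) (b' i) - 1).
    by rewrite f1 ltW.
  rewrite subrK; apply/andP; split.
    by apply: le_trans f1; rewrite ler_int ltW.
  by case: (leP (b i) (b' i)).
have fa : a i <= f i by rewrite floor_ge_int; case/andP: (hx i).
have fa' : a' i <= f i by rewrite floor_ge_int; case/andP: (hx' i).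
by have := ne i; lia.
Qed.

Lemma cellsE {R : realType} {d : nat} (l : nat) (Q : set 'rV[R]_d) :
  cells l Q <-> exists2 k, Q = dyadic_cell l k &
                          forall i, 0 <= k i < (2 ^ l)%N%:Z.
Proof.
rewrite /cells /= (unit_cubeE l); split=> [[/cells_inftyE[k ->]]|[k -> hk]].
  by move/cell_sub_box; exists k.
by split; [apply/cells_inftyE; exists k|apply/cell_sub_box].
Qed.

Lemma dyadic_box_unit_cell {R : realType} {d : nat} (l : nat)
    (a b : 'I_d -> int) (x : 'rV[R]_d) :
  (forall i, Order.max (a i) 0 < Order.min (b i) (2 ^ l)%N%:Z) ->
  dyadic_box l a b x -> unit_cube x ->
  exists2 m : 'I_d -> int,
    dyadic_cell l m x & forall i, a i <= m i < b i /\ 0 <= m i < (2 ^ l)%N%:Z.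
Proof. by rewrite (unit_cubeE l); exact: dyadic_box_cell. Qed.

(** * Hats, parents and coarse neighbourhoods as boxes *)

Lemma hatE {R : realType} {d : nat} (p l : nat) (k : 'I_d -> int) :
  hat p l%:Z (@dyadic_cell R d l k) =
  dyadic_box l (fun i => k i - p%:Z) (fun i => k i + p%:Z + 1).
Proof.
apply/seteqP; split=> x.
  move=> [C [/bspline_cubesE[j ->] /cell_sub_box jk]].
  by apply: dyadic_box_mono => i; have := jk i; lia.
move=> hx.
(* The cube starting at k or the one ending at k + 1, in each coordinate. *)
pose j i := if (k i)%:~R <= 2 ^+ l * x ord0 i then k i else k i - p%:Z.
exists (dyadic_box l j (fun i => j i + p.+1%:Z)).
  split; first by apply/bspline_cubesE; exists j.
  by apply/cell_sub_box => i; rewrite /j; case: ifP; lia.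
move=> i; have /andP[h1 h2] := hx i; rewrite /j.
have e : k i + p.+1%:Z = k i + p%:Z + 1 by lia.
case: (leP (k i)%:~R) => [le|/ltW h]; first by rewrite le e h2.
rewrite h1 (le_trans h) // ler_int; lia.
Qed.

Lemma parentE {R : realType} {d : nat} (l : nat) (k : 'I_d -> int) :
  parent l.+1%:Z (@dyadic_cell R d l.+1 k) =
  dyadic_cell l (fun i => (k i %/ 2)%Z).
Proof.
rewrite /parent (_ : l.+1%:Z - 1 = l%:Z); last by lia.
set S := [set _ | _].
have SE P : S P <-> P = dyadic_cell l (fun i => (k i %/ 2)%Z).
  split=> [[/cells_inftyE[a ->]]|->].
    rewrite {2}/dyadic_cell dyadic_box_refine => /cell_sub_box h.
    by congr dyadic_cell; apply: funext => i; have := h i; lia.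
  split; first by apply/cells_inftyE; eexists.
  by rewrite {2}/dyadic_cell dyadic_box_refine; apply/cell_sub_box => i; lia.
by apply/SE; apply: (@getI _ S (dyadic_cell l (fun i => (k i %/ 2)%Z)));
  apply/SE.
Qed.

Lemma coarse_nbhdE {R : realType} {d : nat} (p l : nat) (k : 'I_d -> int) :
  coarse_nbhd p l.+1%:Z (@dyadic_cell R d l.+1 k) =
  dyadic_box l (fun i => ((k i - p%:Z) %/ 2)%Z)
               (fun i => ((k i + p%:Z) %/ 2)%Z + 1).
Proof.
rewrite /coarse_nbhd hatE; apply/seteqP; split=> x.
  move=> [_ [/cells_inftyE[m ->] /cell_sub_box hm]]; rewrite parentE.
  by apply: dyadic_box_mono => i; have := hm i; lia.
move=> hx; have [|a xa ha] := dyadic_box_cell _ _ _ _ _ _ _ hx hx.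
  by move=> i; lia.
(* The lower child of a, unless it falls just below the hat. *)
pose m i := Order.max (2 * a i) (k i - p%:Z).
exists (dyadic_cell l.+1 m).
  split; first by apply/cells_inftyE; exists m.
  by apply/cell_sub_box => i; have := ha i; rewrite /m; lia.
rewrite parentE (_ : (fun _ => _) = a) //.
by apply: funext => i; have := ha i; rewrite /m; lia.
Qed.

(** * Supports of B-splines *)

Lemma cardinal_bspline_eq0 {R : realType} (q : nat) (x : R) :
  ~~ (0 <= x <= q%:R + 1) -> cardinal_bspline q x = 0.
Proof.
elim: q x => [|q IH] x /= hx.
  by case: ifP => // h; move: hx; rewrite negb_and -!ltNge; lra.
rewrite !IH ?mulr0 ?addr0 //; move: hx; rewrite -natr1 !negb_and -!ltNge;
  have := ler0n R q; lra.
Qed.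

Lemma cardinal_bspline_ge0 {R : realType} (q : nat) (x : R) :
  0 <= cardinal_bspline q x.
Proof.
elim: q x => [|q IH] x; first by rewrite /=; case: ifP.
have [|/cardinal_bspline_eq0-> //] := boolP (0 <= x <= q.+1%:R + 1).
move=> /andP[h1 h2] /=; rewrite addr_ge0 // mulr_ge0 // divr_ge0 //; lra.
Qed.

(** Both terms of the recursion are nonnegative on the support. The first
one is positive by induction before the last knot interval, the second one on
that interval. *)
Lemma cardinal_bspline_gt0 {R : realType} (q : nat) (x : R) :
  0 < x < q%:R + 1 -> 0 < cardinal_bspline q x.
Proof.
elim: q x => [|q IH] x; first by rewrite /= => h; rewrite ifT //; lra.
have q0 : 0 < q.+1%:R :> R by rewrite ltr0n.
move=> hx; have [h|h] := ltP x (q%:R + 1) => /=.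
  apply: ltr_pwDl; first by rewrite mulr_gt0 ?divr_gt0 ?IH //; lra.
  by rewrite mulr_ge0 ?cardinal_bspline_ge0 // divr_ge0 //; lra.
apply: ltr_wpDl.
  by rewrite mulr_ge0 ?cardinal_bspline_ge0 // divr_ge0 //; lra.
rewrite mulr_gt0 ?divr_gt0 //; first by lra.
(* For degree 1, [x = 1] evaluates the degree 0 spline at its left end 0,
   where it equals 1 although 0 is not an interior point. *)
case: q IH {q0} hx h => [|q] IH hx h; first by rewrite /= ifT //; lra.
by apply: IH; move: hx h; rewrite -!natr1; have := ler0n R q; lra.
Qed.

Lemma dyadic_box_closed {R : realType} {d : nat} (l : nat)
    (a b : 'I_d -> int) : closed (@dyadic_box R d l a b).
Proof.
have h := pow2_gt0 R l.
rewrite (_ : dyadic_box l a b = \bigcap_(i in [set: 'I_d])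
  ((fun x : 'rV[R]_d => x ord0 i) @^-1`
     [set` `[(a i)%:~R / 2 ^+ l, (b i)%:~R / 2 ^+ l]])).
  apply: closed_bigI => i _; apply: preimage_closed; last exact: itv_closed.
  by move=> x _; exact: coord_continuous.
apply/seteqP; split=> x hx i; have := hx i.
  by move=> + _ /=; rewrite in_itv /= ler_pdivrMr // ler_pdivlMr // mulrC.
by move=> /(_ I) /=; rewrite in_itv /= ler_pdivrMr // ler_pdivlMr // mulrC.
Qed.

(** Each point of the closed box is approximated by points of the open box, on
which the product of positive factors does not vanish. *)
Lemma closure_tensor_bspline {R : realType} {d : nat} (p l : nat)
    (k : 'I_d -> int) :
  closure [set x : 'rV[R]_d | tensor_bspline p l k x != 0] =
  dyadic_box l k (fun i => k i + p.+1%:Z).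
Proof.
have h := pow2_gt0 R l.
have castE i : (k i + p.+1%:Z)%:~R = (k i)%:~R + (p%:R + 1) :> R.
  by rewrite intrD -pmulrn -natr1.
apply/seteqP; split.
  rewrite [X in _ `<=` X](closure_id _).1; last exact: dyadic_box_closed.
  apply: closureS => x /= /prodf_neq0 hx i; rewrite castE.
  have [hi|/cardinal_bspline_eq0 e0] :=
      boolP (0 <= 2 ^+ l * x ord0 i - (k i)%:~R <= p%:R + 1); first by lra.
  by have := hx i isT; rewrite e0 eqxx.
move=> x hx B /nbhs_ballP[e /= e0 eB].
(* Moving each scaled coordinate by del, away from the lower end when it is
   within 1/2 of it and downwards otherwise, enters the open box and, by the
   choice of del, stays in the ball of radius e. *)
pose del := Order.min (2 ^+ l * e / 2) 4^-1.
have del0 : 0 < del.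
  by rewrite /del lt_min invr_gt0 !ltr0n divr_gt0 ?mulr_gt0.
have del1 : del <= 4^-1 by rewrite /del ge_min lexx orbT.
have del2 : del <= 2 ^+ l * e / 2 by rewrite /del ge_min lexx.
pose z i := 2 ^+ l * x ord0 i.
pose t i := if z i <= (k i)%:~R + 2^-1 then z i + del else z i - del.
exists (grid_point l t); split.
  apply/prodf_neq0 => i _.
  rewrite gt_eqF // cardinal_bspline_gt0 // grid_pointE.
  have := hx i; rewrite castE -/(z i) /t; have := ler0n R p.
  by case: (leP _ ((k i)%:~R + 2^-1)); lra.
apply: eB; split=> // i j; rewrite ord1 /ball /= mxE.
rewrite -(ltr_pM2l h) -{1}(gtr0_norm h) -normrM mulrBr -/(z j) mulrC divrK.
  by rewrite /t ltr_norml; case: ifP => _; lra.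
by rewrite unitfE; lra.
Qed.

(** A spline whose support contains a cell of the unit cube is automatically a
basis function: it is positive at the center of the cell. *)
Lemma support_extE {R : realType} {d : nat} (p l : nat) (k : 'I_d -> int) :
  (forall i, 0 <= k i < (2 ^ l)%N%:Z) ->
  support_ext p l (@dyadic_cell R d l k) =
  hat p l%:Z (dyadic_cell l k) `&` @unit_cube R d.
Proof.
move=> hk; apply/seteqP; split=> x.
  move=> [_ [[j [-> _]] sub]]; rewrite /supp closure_tensor_bspline in sub *.
  move=> [hx ux]; split=> //.
  exists (dyadic_box l j (fun i => j i + p.+1%:Z)) => //.
  by split; [apply/bspline_cubesE; exists j|move=> y /sub[]].
move=> [[_ [/bspline_cubesE[j ->] sub] hx] ux].
have cu : dyadic_cell l k `<=` @unit_cube R d.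
  by rewrite (unit_cubeE l); apply/cell_sub_box.
exists (tensor_bspline p l j); last by rewrite /supp closure_tensor_bspline.
split; last by rewrite /supp closure_tensor_bspline => y yk; split; auto.
exists j; split=> //; exists (cell_center l k); first exact/cu/cell_center_in.
apply/prodf_neq0 => i _; rewrite gt_eqF // cardinal_bspline_gt0 // grid_pointE.
have /cell_sub_box/(_ i)/andP[h1 h2] := sub.
have h3 : k i + 1 <= j i + p.+1%:Z by lia.
by move: h1 h3; rewrite -!(ler_int R) !intrD -pmulrn -(natr1 p); lra.
Qed.

(** * The two implications at a fixed level *)

(** The bounds on [k0] express that the hat, of width [2 * p + 1], fits into the
p-form, of width [2 * p + 2] in units of the finer level. *)
Lemma pforms_cell {R : realType} {d : nat} (p l : nat) (C : set 'rV[R]_d) :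
  pforms p l%:Z C -> exists j k0 : 'I_d -> int,
    [/\ C = dyadic_box l j (fun i => j i + p.+1%:Z),
        forall i, 0 <= k0 i < (2 ^ l.+1)%N%:Z &
        forall i, 2 * j i + p%:Z <= k0 i <= 2 * j i + p%:Z + 1].
Proof.
move=> [/bspline_cubesE[j ->] [Q []]].
rewrite (_ : l%:Z + 1 = l.+1%:Z); last by lia.
move=> hQ uQ; have /cellsE[k -> hk] : cells l.+1 Q by [].
rewrite hatE [X in _ `<=` X]dyadic_box_refine.
rewrite dyadic_box_sub => [sub|i]; last by lia.
by exists j, k; split=> // i; have := sub i; lia.
Qed.

(** The center of a cell of level [l + 1] lies in the interior of the parent of
that cell, so among the cells of level [l] only the parent can put it into
[omega p Om l]. *)
Lemma support_ext_center {R : realType} {d : nat} (p l : nat)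
    (Om : nat -> set 'rV[R]_d) (k : 'I_d -> int) :
  omega p Om l (cell_center l.+1 k) ->
  support_ext p l (dyadic_cell l (fun i => (k i %/ 2)%Z)) `<=` Om l.
Proof.
move=> [_ [/cellsE[a -> ha] sub]].
rewrite {1}/dyadic_cell dyadic_box_refine => /center_in_box hc.
rewrite (_ : (fun _ => _) = a) //.
by apply: funext => i; have := hc i; lia.
Qed.

Lemma pow2S (l : nat) : (2 ^ l.+1)%N%:Z = 2 * (2 ^ l)%N%:Z.
Proof. by rewrite expnS; lia. Qed.

Lemma coarse_nbhd_sub_of_omega {R : realType} {d : nat} (p l : nat)
    (Om : nat -> set 'rV[R]_d) (A : set (set 'rV[R]_d)) :
  Om 0%N = @unit_cube R d ->
  A `<=` pforms p l%:Z -> Om l.+1 = \bigcup_(C in A) (C `&` Om 0%N) ->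
  omega p Om l.+1 `<=` omega p Om l ->
  forall Q, cells l.+1 Q -> Q `<=` Om l.+1 ->
    coarse_nbhd p l.+1%:Z Q `&` Om 0%N `<=` Om l.
Proof.
move=> Om0 Apf OmE sub _ /cellsE[k -> hk] QOm y.
rewrite Om0 coarse_nbhdE => -[yN yu].
have [C AC] : exists2 C, A C & C (cell_center l.+1 k).
  by have := QOm _ (cell_center_in l.+1 k); rewrite OmE => -[C AC []]; exists C.
have [j [k0 [CE hk0 jk0]]] := pforms_cell _ _ _ (Apf _ AC).
rewrite CE dyadic_box_refine => /center_in_box jk.
have [|b yb hb] := dyadic_box_unit_cell _ _ _ _ _ yN yu.
  by move=> i; move: (hk i) (pow2S l); lia.
(* The larger admissible coordinate is used when it is at most 2b: then the cell
   inherits its upper bound from b and its lower bound from k0. The smaller one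
   is used otherwise, with the roles of b and k0 exchanged. *)
pose k1 i := if 2 * j i + p%:Z + 1 <= 2 * b i
             then 2 * j i + p%:Z + 1 else 2 * j i + p%:Z.
have hk1 i : 0 <= k1 i < (2 ^ l.+1)%N%:Z.
  by rewrite /k1; move: (pow2S l) (hb i) (jk0 i) (hk0 i); case: ifP; lia.
have : omega p Om l.+1 (cell_center l.+1 k1).
  exists (dyadic_cell l.+1 k1); last exact: cell_center_in.
  split; first by apply/cellsE; exists k1.
  rewrite support_extE // OmE Om0 => x [xh xu]; exists C => //; split=> //.
  rewrite CE dyadic_box_refine; move: x xh {xu}; rewrite hatE.
  by apply: dyadic_box_mono => i; rewrite /k1; case: ifP; lia.
move=> /sub/support_ext_center; apply.
rewrite support_extE => [|i]; last by move: (hk1 i) (pow2S l); lia.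
split=> //; rewrite hatE; move: yb; apply: dyadic_box_mono => i.
by move: (hb i) (jk i); rewrite /k1; case: ifP; lia.
Qed.

Lemma omega_sub_of_coarse_nbhd {R : realType} {d : nat} (p l : nat)
    (Om : nat -> set 'rV[R]_d) :
  (forall Q, cells l.+1 Q -> Q `<=` Om l.+1 ->
    coarse_nbhd p l.+1%:Z Q `&` @unit_cube R d `<=` Om l) ->
  omega p Om l.+1 `<=` omega p Om l.
Proof.
move=> nb x [_ [/cellsE[k -> hk] QOm] xQ].
pose a i := (k i %/ 2)%Z.
have ha i : 0 <= a i < (2 ^ l)%N%:Z.
  by move: (hk i) (pow2S l); rewrite /a; lia.
exists (dyadic_cell l a); last first.
  rewrite /dyadic_cell dyadic_box_refine; move: xQ.
  by apply: dyadic_box_mono => i; rewrite /a; lia.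
split; first by apply/cellsE; exists a.
rewrite support_extE // hatE => y [yh yu].
have [|m ym hm] := dyadic_box_unit_cell _ _ _ _ _ yh yu.
  by move=> i; have := ha i; lia.
(* The child q of m has the parity of k, so that |q - k| = 2 |m - a| <= 2p, and
   its projection k1 onto [k - p, k + p] is within p of q. *)
pose q i := 2 * m i + (k i %% 2)%Z.
pose k1 i := Order.max (k i - p%:Z) (Order.min (q i) (k i + p%:Z)).
have hk1 i : 0 <= k1 i < (2 ^ l.+1)%N%:Z.
  by move: (hm i) (hk i) (pow2S l); rewrite /k1 /q; lia.
apply: (nb (dyadic_cell l.+1 k1)).
- by apply/cellsE; exists k1.
- apply: subset_trans QOm; rewrite support_extE // => z zk1; split.
    by rewrite hatE; move: z zk1; apply/cell_sub_box => i; rewrite /k1; lia.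
  by rewrite (unit_cubeE l.+1); move: z zk1; apply/cell_sub_box.
split=> //; rewrite coarse_nbhdE; move: ym.
by apply: dyadic_box_mono => i; have := hm i; rewrite /k1 /q /a; lia.
Qed.

Theorem theorem2p23 (R : realType) (d p n : nat) (Om : nat -> set 'rV[R]_d)
    (hd : (1 <= d)%N) (hp : (1 <= p)%N)
    (hOm : hierarchy n Om) (hcl : clustered p n Om) :
  WAHM p n Om (hierarchical_mesh n Om) <->
  (forall l : nat, (1 <= l < n)%N ->
   forall Q : set 'rV[R]_d, cells l Q -> Q `<=` Om l ->
     coarse_nbhd p l%:Z Q `&` Om 0%N `<=` Om l.-1).
Proof.
have [Om0 _ _ _] := hOm.
split=> [[_ sub] [//|l] ln|nb].
  have [A Apf OmE] := hcl _ ln.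
  rewrite (_ : l.+1%:Z - 1 = l%:Z) in Apf; last by lia.
  exact: (coarse_nbhd_sub_of_omega _ _ _ _ Om0 Apf OmE (sub _ ln)).
split=> // -[//|l] ln; apply: omega_sub_of_coarse_nbhd.
by rewrite -Om0; exact: nb ln.
Qed.
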